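(* Let $n\geq 4$ and $N_1,\dots,N_n\geq 0$ be integers. Let $Q$ be the quiver with vertices $1,\dots,n$, arrows $x_i:i-1\to i$ for $2\le i\le n-2$, $x_{n-1}:n-2\to n-1$, $x_n:n-2\to n$, and $N_i$ loops at vertex $i$ for each $i$. Let $D(n)=\Bbbk Q/(\geq 2)$. Then $$\operatorname{fpd}\big(D(n)\text{-mod}\big)=\max\{N_1,\dots,N_n\}.$$
   Context: $\Bbbk$ is an algebraically closed field; $\Bbbk Q$ is the path algebra with $e_i\alpha=\delta_{i,t(\alpha)}\alpha$, $\alpha e_j=\delta_{j,s(\alpha)}\alpha$; $(\geq 2)$ is the ideal generated by paths of length $\geq 2$; $A\text{-mod}$ is the category of finite-dimensional left $A$-modules. For a $\Bbbk$-linear abelian category $\mathcal C$: an object $M$ is a brick if $\mathrm{Hom}(M,M)=\Bbbk$; a finite set $\phi=\{X_1,\dots,X_m\}$ of nonzero objects is a brick set if each $X_i$ is a brick and $\dim\mathrm{Hom}(X_i,X_j)=\delta_{ij}$; its adjacency matrix is $A(\phi)=(\dim\mathrm{Ext}^1_{\mathcal C}(X_i,X_j))_{i,j}$; and $\operatorname{fpd}(\mathcal C)=\sup_{\phi}\rho(A(\phi))$, the supremum over all brick sets of the spectral radius $\rho$. *)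

(* Defs.v *)
From HB Require Import structures.
From mathcomp Require Import all_boot all_order all_algebra all_field.
Set Implicit Arguments. Unset Strict Implicit. Unset Printing Implicit Defensive.
Import Order.TTheory GRing.Theory Num.Theory.
Local Open Scope ring_scope.

(* Finitely presented algebras with (at most) quadratic relations.          *)
(* An algebra A is given by a finite set of generators and a finite set of  *)
(* relations  sum_{g,h} q2 r g h * g h + sum_g q1 r g * g + q0 r * 1 = 0.   *)
(* A (finite-dimensional, left) A-module is k^m together with a matrix      *)
(* (acting on column vectors) for each generator satisfying the relations.  *)
Record qpres (K : fieldType) := QPres {
  gen : finType;
  rel : finType;
  q0 : rel -> K;
  q1 : rel -> gen -> K;
  q2 : rel -> gen -> gen -> K }.

Definition rel_value (K : fieldType) (P : qpres K) m (rho : gen P -> 'M[K]_m)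
    (r : rel P) : 'M[K]_m :=
  \sum_(g : gen P) \sum_(h : gen P) q2 r g h *: (rho g *m rho h)
  + \sum_(g : gen P) q1 r g *: rho g + q0 r *: 1%:M.

Record module (K : fieldType) (P : qpres K) := Module {
  mdim : nat;
  mact : gen P -> 'M[K]_mdim;
  maxiom : forall r : rel P, rel_value mact r = 0 }.

Definition homspace (K : fieldType) (P : qpres K) (M N : module P)
  : {vspace 'M[K]_(mdim N, mdim M)} :=
  (\bigcap_(g : gen P)
     lker (linfun (fun f : 'M[K]_(mdim N, mdim M) =>
                     f *m mact M g - mact N g *m f)))%VS.

Arguments homspace {K P} M N.

Definition dimHom (K : fieldType) (P : qpres K) (M N : module P) : nat :=
  \dim (homspace M N).

(* Ext^1_A(M, N) via extensions 0 -> N -> E -> M -> 0: E = N (+) M with      *)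
(* action [[rho_N g, d g], [0, rho_M g]].  E is an A-module iff d lies in    *)
(* the cocycle space Z; two such extensions are equivalent iff the d's       *)
(* differ by a coboundary (element of B).  Ext^1(M,N) = Z / B.               *)
Definition cocycle_rel (K : fieldType) (P : qpres K) (M N : module P)
    (r : rel P) (d : {ffun gen P -> 'M[K]_(mdim N, mdim M)})
    : 'M[K]_(mdim N, mdim M) :=
  \sum_(g : gen P) \sum_(h : gen P)
      q2 r g h *: (mact N g *m d h + d g *m mact M h)
  + \sum_(g : gen P) q1 r g *: d g.

Arguments cocycle_rel {K P} M N r d.

Definition cocycles (K : fieldType) (P : qpres K) (M N : module P)
  : {vspace {ffun gen P -> 'M[K]_(mdim N, mdim M)}} :=
  (\bigcap_(r : rel P) lker (linfun (cocycle_rel M N r)))%VS.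

Definition coboundaries (K : fieldType) (P : qpres K) (M N : module P)
  : {vspace {ffun gen P -> 'M[K]_(mdim N, mdim M)}} :=
  limg (linfun (fun h : 'M[K]_(mdim N, mdim M) =>
          [ffun g => mact N g *m h - h *m mact M g])).

Arguments cocycles {K P} M N.
Arguments coboundaries {K P} M N.

Definition dimExt1 (K : fieldType) (P : qpres K) (M N : module P) : nat :=
  (\dim (cocycles M N) - \dim (coboundaries M N))%N.

Definition brick_set (K : fieldType) (P : qpres K) m (X : 'I_m -> module P)
  : Prop :=
  (forall i, 0 < mdim (X i))%N /\
  (forall i j, dimHom (X i) (X j) = (i == j) :> nat).

Definition adjacency (K : fieldType) (P : qpres K) m (X : 'I_m -> module P)
  : 'M[nat]_m := \matrix_(i, j) dimExt1 (X i) (X j).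

Definition spectral_radius m (A : 'M[nat]_m) : algC :=
  \big[Num.max/0]_(z <- sval (closed_field_poly_normal
                     (char_poly (map_mx (fun k : nat => k%:R : algC) A))))
     `|z|.

Definition fpd_is (K : fieldType) (P : qpres K) (x : algC) : Prop :=
  (forall m (X : 'I_m -> module P), brick_set X ->
      spectral_radius (adjacency X) <= x) /\
  (forall y : algC,
      (forall m (X : 'I_m -> module P), brick_set X ->
          spectral_radius (adjacency X) <= y) -> x <= y).

(* Path algebra of a finite quiver modulo paths of length >= 2.            *)
(* Generators: idempotents e_i (inl i) and arrows (inr a).                  *)
(* Relations: e_i e_j = [i==j] e_i ; sum_i e_i = 1 ;                        *)
(*   e_i a = [i == t a] a ; a e_j = [j == s a] a ; a b = 0.                 *)
Definition rsz_rel (V E : finType) : finType :=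
  ((V * V) + unit + (V * E) + (E * V) + (E * E))%type.

Section RSZ.
Variables (K : fieldType) (V E : finType) (src tgt : E -> V).
Local Notation G := ((V + E)%type : finType).

Definition rsz_q0 (r : rsz_rel V E) : K :=
  match r with inl (inl (inl (inr tt))) => -1 | _ => 0 end.

Definition rsz_q1 (r : rsz_rel V E) (g : G) : K :=
  match r with
  | inl (inl (inl (inl (i, j)))) => - ((i == j) && (g == inl i))%:R
  | inl (inl (inl (inr tt))) => (if g is inl _ then 1 else 0)
  | inl (inl (inr (i, a))) => - ((i == tgt a) && (g == inr a))%:R
  | inl (inr (a, j)) => - ((j == src a) && (g == inr a))%:R
  | inr _ => 0
  end.

Definition rsz_q2 (r : rsz_rel V E) (g h : G) : K :=
  match r with
  | inl (inl (inl (inl (i, j)))) => ((g == inl i) && (h == inl j))%:R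
  | inl (inl (inl (inr tt))) => 0
  | inl (inl (inr (i, a))) => ((g == inl i) && (h == inr a))%:R
  | inl (inr (a, j)) => ((g == inr a) && (h == inl j))%:R
  | inr (a, b) => ((g == inr a) && (h == inr b))%:R
  end.

Definition rsz_pres : qpres K := @QPres K G (rsz_rel V E) rsz_q0 rsz_q1 rsz_q2.
End RSZ.

(* The quiver of the theorem, vertices 1..n encoded as 0..n-1 in 'I_n.      *)
(* Non-loop arrows indexed by a : 'I_(n-1), a = (index of x) - 2:            *)
(*  x_{a+2} : a -> a+1  (0-based) for a <= n-3, and x_n : n-3 -> n-1.       *)
Definition D_arrow n (N : 'I_n -> nat) : finType :=
  ('I_n.-1 + {i : 'I_n & 'I_(N i)})%type.

Lemma D_succ_lt n (b : 'I_n.-1) : (b.+1 < n)%N.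
Proof. case: b => b /= hb. by case: n hb. Qed.

Lemma D_nm3_lt n (b : 'I_n.-1) : (n - 3 < n)%N.
Proof. case: b => b /= hb. case: n hb => [//|n _]. rewrite ltn_subrL. by []. Qed.

Lemma D_self_lt n (b : 'I_n.-1) : (b < n)%N.
Proof. exact: ltn_trans (ltnSn b) (D_succ_lt b). Qed.

Definition D_src n (N : 'I_n -> nat) (a : D_arrow N) : 'I_n :=
  match a with
  | inl b => if (b == (n - 2)%N :> nat) then Ordinal (D_nm3_lt b)
             else Ordinal (D_self_lt b)
  | inr l => tag l
  end.

Definition D_tgt n (N : 'I_n -> nat) (a : D_arrow N) : 'I_n :=
  match a with
  | inl b => Ordinal (D_succ_lt b)
  | inr l => tag l
  end.

Definition D_pres (K : fieldType) n (N : 'I_n -> nat) : qpres K :=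
  rsz_pres K (@D_src n N) (@D_tgt n N).

(* Main.v *)
(* In a brick, two consecutive arrows cannot both act nontrivially: a rank-one
   map that factors through the second and lands in the image of the first would
   be a nonzero nilpotent endomorphism. So loops act by zero,
   and, the quiver being a forest with all arrows pointing away from the roots,
   a brick lives on one vertex (its root) and on the targets of some of the
   arrows leaving it. As at most two arrows leave each vertex, a rank-one
   endomorphism at the root extends to the brick, which is therefore
   one-dimensional at each vertex of its support.

   The value of a cocycle at a loop is a homomorphism, so within a brick set
   the loops contribute to the diagonal of the adjacency matrix only, by at most
   the number of loops at the root. Between members of a brick set, a cocycle
   vanishing on loops is a coboundary as soon as the root of the second module
   does not exceed that of the first. Hence
   the adjacency matrix is triangular for the order of the roots and its
   eigenvalues are diagonal entries. The simple modules attain the bound. *)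
Require Import Defs.
From HB Require Import structures.
From mathcomp Require Import all_boot all_order all_algebra all_field.
From mathcomp Require Import zify.
Import Order.TTheory GRing.Theory Num.Theory.
Local Open Scope ring_scope.

Set Implicit Arguments.
Unset Strict Implicit.

(** The definitions of [homspace], [cocycles] and [coboundaries] apply [linfun] to bare functions.
    Once such a function is proved linear, packing the structure locally lets [lfunE] evaluate
    it. *)
Lemma linfun_linearE (K : fieldType) (U W : vectType K) (f : U -> W) :
  linear f -> linfun f =1 f.
Proof.
move=> fL.
pose L := GRing.isLinear.Build K U W _ f fL.
pose ff : {linear U -> W} := HB.pack f L.
exact: (lfunE ff).
Qed.

(** * Sums weighted by Kronecker deltas, as they occur in the quadratic relations *)

Section DeltaSums.
Variables (K : fieldType) (V E : finType) (U : lmodType K).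
Local Notation G := (V + E)%type.

Lemma sum_delta (x : G) (b : bool) (F : G -> U) :
  \sum_g (b && (g == x))%:R *: F g = b%:R *: F x.
Proof.
rewrite (bigD1 x) //= eqxx andbT big1 ?addr0 // => g /negbTE ->.
by rewrite andbF scale0r.
Qed.

Lemma sum_deltaN (x : G) (b : bool) (F : G -> U) :
  \sum_g (- (b && (g == x))%:R) *: F g = - (b%:R *: F x).
Proof.
by rewrite -(sum_delta x) -sumrN; apply: eq_bigr => g _; rewrite scaleNr.
Qed.

Lemma sum_delta2 (x y : G) (F : G -> G -> U) :
  \sum_g \sum_h ((g == x) && (h == y))%:R *: F g h = F x y.
Proof.
under eq_bigr => g _ do rewrite sum_delta -[g == x]/(true && (g == x)).
by rewrite sum_delta scale1r.
Qed.

Lemma sum_inl (F : G -> U) :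
  \sum_g (if g is inl _ then 1 else 0) *: F g = \sum_v F (inl v).
Proof.
rewrite big_sumType /= [X in _ + X]big1 ?addr0 => [|e _]; last exact: scale0r.
by apply: eq_bigr => v _; rewrite scale1r.
Qed.

Lemma sum_scale0 (F : G -> U) : \sum_g 0 *: F g = 0.
Proof. by rewrite big1 // => g _; rewrite scale0r. Qed.

Lemma sum_scale00 (F : G -> G -> U) : \sum_g \sum_h 0 *: F g h = 0.
Proof. by rewrite big1 // => g _; rewrite sum_scale0. Qed.

End DeltaSums.

(** * Modules as representations: idempotents, arrows and homomorphisms *)

Section Modules.
Variables (K : fieldType) (n : nat) (E : finType) (src tgt : E -> 'I_n).
Local Notation P := (rsz_pres K src tgt).
Implicit Types (X Y : module P) (i j k : 'I_n) (a b c : E).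

Definition idm X k : 'M_(mdim X) := @mact K P X (inl k).
Definition arr X a : 'M_(mdim X) := @mact K P X (inr a).

Lemma idm_idm X k j : idm X k *m idm X j = (k == j)%:R *: idm X k.
Proof.
have := @maxiom K P X (inl (inl (inl (inl (k, j))))).
rewrite /rel_value /= sum_delta2 sum_deltaN scale0r addr0 => /eqP.
by rewrite subr_eq0 => /eqP.
Qed.

Lemma sum_idm X : \sum_k idm X k = 1%:M.
Proof.
have := @maxiom K P X (inl (inl (inl (inr tt)))).
rewrite /rel_value /= sum_scale00 add0r sum_inl scaleN1r => /eqP.
by rewrite subr_eq0 => /eqP.
Qed.

Lemma idm_arr X k a : idm X k *m arr X a = (k == tgt a)%:R *: arr X a.
Proof.
have := @maxiom K P X (inl (inl (inr (k, a)))).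
rewrite /rel_value /= sum_delta2 sum_deltaN scale0r addr0 => /eqP.
by rewrite subr_eq0 => /eqP.
Qed.

Lemma arr_idm X k a : arr X a *m idm X k = (k == src a)%:R *: arr X a.
Proof.
have := @maxiom K P X (inl (inr (a, k))).
rewrite /rel_value /= sum_delta2 sum_deltaN scale0r addr0 => /eqP.
by rewrite subr_eq0 => /eqP.
Qed.

Lemma arr_arr X a b : arr X a *m arr X b = 0.
Proof.
have := @maxiom K P X (inr (a, b)).
by rewrite /rel_value /= sum_delta2 sum_scale0 scale0r !addr0.
Qed.

Lemma idm_id X k : idm X k *m idm X k = idm X k.
Proof. by rewrite idm_idm eqxx scale1r. Qed.

Lemma idm_tgt X a : idm X (tgt a) *m arr X a = arr X a.
Proof. by rewrite idm_arr eqxx scale1r. Qed.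

Lemma arr_src X a : arr X a *m idm X (src a) = arr X a.
Proof. by rewrite arr_idm eqxx scale1r. Qed.

Lemma homspaceP X Y (f : 'M_(mdim Y, mdim X)) :
  reflect (forall g : gen P, f *m mact X g = mact Y g *m f)
          (f \in homspace X Y).
Proof.
have hL (g : gen P) : linear (fun f : 'M_(mdim Y, mdim X) =>
    f *m mact X g - mact Y g *m f).
  move=> c u v; rewrite mulmxDl mulmxDr -scalemxAl -scalemxAr scalerBr.
  by rewrite opprD addrACA.
apply: (iffP idP) => [fH g|fH].
  have /subv_bigcapP/(_ g isT) : (<[f]> <= homspace X Y)%VS by rewrite -memvE.
  by rewrite -memvE memv_ker linfun_linearE // subr_eq0 => /eqP.
rewrite memvE; apply/subv_bigcapP => g _.
by rewrite -memvE memv_ker linfun_linearE // fH subrr.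
Qed.

Lemma homP X Y (f : 'M_(mdim Y, mdim X)) :
    (forall k, f *m idm X k = idm Y k *m f) ->
    (forall a, f *m arr X a = arr Y a *m f) ->
  f \in homspace X Y.
Proof. move=> fv fa; apply/homspaceP; case; [exact: fv | exact: fa]. Qed.

(** * Cocycles as derivations, coboundaries as inner derivations *)

Section Cocycles.
Variables X Y : module P.
Implicit Types d : {ffun gen P -> 'M[K]_(mdim Y, mdim X)}.

Definition cidm d k : 'M_(mdim Y, mdim X) := d (inl k).
Definition carr d a : 'M_(mdim Y, mdim X) := d (inr a).

Lemma cocycle_rel_linear r : linear (@cocycle_rel K P X Y r).
Proof.
move=> c u v; rewrite /cocycle_rel scalerDr addrACA.
congr (_ + _); rewrite scaler_sumr -big_split; apply: eq_bigr => g _ /=.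
  rewrite scaler_sumr -big_split; apply: eq_bigr => h _ /=.
  rewrite !ffunE mulmxDl mulmxDr -scalemxAl -scalemxAr addrACA -scalerDr.
  by rewrite [LHS]scalerDr !scalerA mulrC.
by rewrite !ffunE [LHS]scalerDr !scalerA mulrC.
Qed.

Lemma cocycleP d :
  reflect (forall r, @cocycle_rel K P X Y r d = 0) (d \in cocycles X Y).
Proof.
apply: (iffP idP) => [dZ r|dZ].
  have /subv_bigcapP/(_ r isT) : (<[d]> <= cocycles X Y)%VS by rewrite -memvE.
  by rewrite -memvE memv_ker (linfun_linearE (@cocycle_rel_linear r)) => /eqP.
rewrite memvE; apply/subv_bigcapP => r _.
by rewrite -memvE memv_ker (linfun_linearE (@cocycle_rel_linear r)) dZ.
Qed.

(** Linearising a relation of the algebra gives a Leibniz rule for [d]. This lemma and the next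
    three spell it out for the four families of quadratic relations. *)
Lemma cocycle_idm_idm d k j : d \in cocycles X Y ->
  idm Y k *m cidm d j + cidm d k *m idm X j = (k == j)%:R *: cidm d k.
Proof.
move=> /cocycleP/(_ (inl (inl (inl (inl (k, j)))))).
rewrite /cocycle_rel /= sum_delta2 sum_deltaN => /eqP.
by rewrite subr_eq0 => /eqP.
Qed.

Lemma cocycle_idm_arr d k a : d \in cocycles X Y ->
  idm Y k *m carr d a + cidm d k *m arr X a = (k == tgt a)%:R *: carr d a.
Proof.
move=> /cocycleP/(_ (inl (inl (inr (k, a))))).
rewrite /cocycle_rel /= sum_delta2 sum_deltaN => /eqP.
by rewrite subr_eq0 => /eqP.
Qed.

Lemma cocycle_arr_idm d k a : d \in cocycles X Y ->
  arr Y a *m cidm d k + carr d a *m idm X k = (k == src a)%:R *: carr d a.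
Proof.
move=> /cocycleP/(_ (inl (inr (a, k)))).
rewrite /cocycle_rel /= sum_delta2 sum_deltaN => /eqP.
by rewrite subr_eq0 => /eqP.
Qed.

Lemma cocycle_arr_arr d a b : d \in cocycles X Y ->
  arr Y a *m carr d b + carr d a *m arr X b = 0.
Proof.
move=> /cocycleP/(_ (inr (a, b))).
by rewrite /cocycle_rel /= sum_delta2 sum_scale0 addr0.
Qed.

Definition coboundary (h : 'M_(mdim Y, mdim X)) :
    {ffun gen P -> 'M[K]_(mdim Y, mdim X)} :=
  [ffun g => mact Y g *m h - h *m mact X g].

Lemma coboundary_linear : linear coboundary.
Proof.
move=> c u v; apply/ffunP => g; rewrite !ffunE mulmxDl mulmxDr.
by rewrite -scalemxAl -scalemxAr scalerBr opprD addrACA.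
Qed.

Lemma coboundariesP d :
  reflect (exists h, d = coboundary h) (d \in coboundaries X Y).
Proof.
have cE := linfun_linearE coboundary_linear.
apply: (iffP memv_imgP) => [[h _ ->]|[h ->]]; exists h => //.
exact: memvf.
Qed.

Lemma cidm_coboundary h k :
  cidm (coboundary h) k = idm Y k *m h - h *m idm X k.
Proof. by rewrite /cidm ffunE. Qed.

Lemma carr_coboundary h a :
  carr (coboundary h) a = arr Y a *m h - h *m arr X a.
Proof. by rewrite /carr ffunE. Qed.

Lemma coboundaries_cocycle h : coboundary h \in cocycles X Y.
Proof.
apply/cocycleP => r.
(* In the linearised relation the middle terms [mact Y g *m h *m mact X g'] cancel, and so do the
   constant terms. What remains is the commutator of [h] with the relation itself, which vanishes on
   both modules. *)
suff -> : @cocycle_rel K P X Y r (coboundary h) =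
    rel_value (mact Y) r *m h - h *m rel_value (mact X) r.
  by rewrite !maxiom mulmx0 mul0mx subrr.
rewrite /cocycle_rel /rel_value !mulmxDl !mulmxDr.
rewrite -!scalemxAl -!scalemxAr mul1mx mulmx1 opprD addrACA subrr addr0 opprD.
rewrite addrACA.
rewrite !mulmx_suml !mulmx_sumr -!sumrB; congr (_ + _).
  apply: eq_bigr => g _.
  rewrite mulmx_suml mulmx_sumr -sumrB; apply: eq_bigr => g' _.
  rewrite !ffunE -scalemxAl -scalemxAr -scalerBr mulmxBr mulmxBl !mulmxA.
  by rewrite addrA subrK.
by apply: eq_bigr => g _; rewrite ffunE -scalemxAl -scalemxAr -scalerBr.
Qed.

End Cocycles.
End Modules.

(** * Linear algebra: rank-one maps compatible with two given maps *)

Section MatrixLemmas.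
Variables (K : fieldType).

Lemma mulmx_neq0 m p (u : 'cV[K]_m) (v : 'rV[K]_p) :
  u != 0 -> v != 0 -> u *m v != 0.
Proof.
move=> /cV0Pn[i ui] /rV0Pn[j vj]; apply/eqP => /matrixP/(_ i j).
rewrite !mxE big_ord1 => /eqP; rewrite mulf_eq0 (negbTE ui) /=.
exact/negP.
Qed.

Lemma exists_col m p (A : 'M[K]_(m, p)) : A != 0 ->
  exists x : 'cV_p, A *m x != 0.
Proof.
move=> A0; have [/existsP[j Aj]|] := boolP [exists j, col j A != 0].
  by exists (delta_mx j 0); rewrite -colE.
rewrite negb_exists => /forallP Aj; case/negP: A0.
apply/eqP/matrixP => i j; have /negPn/eqP/matrixP/(_ i 0) := Aj j.
by rewrite !mxE.
Qed.

Lemma exists_row m p (A : 'M[K]_(m, p)) : A != 0 ->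
  exists x : 'rV_m, x *m A != 0.
Proof.
rewrite -trmx_eq0 => /exists_col[x]; rewrite -trmx_eq0 trmx_mul trmxK => h.
by exists x^T.
Qed.

Lemma exists_dual m (u : 'cV[K]_m) : u != 0 -> exists v : 'rV_m, v *m u = 1%:M.
Proof.
move=> /cV0Pn[i ui]; exists ((u i 0)^-1 *: delta_mx 0 i).
by rewrite -scalemxAl -rowE; apply/matrixP => a b; rewrite !mxE !ord1 mulVf.
Qed.

(** Either [A] kills a nonzero vector of the image of the idempotent [E], or [A] is injective there
    and has a left inverse on it. Stacking [A] on [1 - E] decides which: the common kernel of the
    two is the kernel of [A] inside the image of [E]. *)
Lemma kernel_or_factor m (E A : 'M[K]_m) : E *m E = E -> A *m E = A ->
  (exists x : 'cV_m, [/\ x != 0, E *m x = x & A *m x = 0]) \/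
  (exists C, E = C *m A).
Proof.
move=> EE AE; have [/row_fullP[C]|] := boolP (row_full (col_mx A (1%:M - E))).
  rewrite -[C]hsubmxK mul_row_col => CE; right; exists (lsubmx C).
  rewrite -[LHS]mul1mx -CE mulmxDl -!mulmxA AE mulmxBl mul1mx EE subrr.
  by rewrite mulmx0 addr0.
rewrite -cokermx_eq0 => /exists_col[y y0]; left.
exists (cokermx (col_mx A (1%:M - E)) *m y).
have : col_mx A (1%:M - E) *m (cokermx (col_mx A (1%:M - E)) *m y) = 0.
  by rewrite mulmxA mulmx_coker mul0mx.
rewrite mul_col_mx -[0 in RHS]col_mx0 => /eq_col_mx[-> /eqP].
by rewrite mulmxBl mul1mx subr_eq0 => /eqP.
Qed.

(** The disjunctions say that the rank-one map [x *m phi] induces a map on the targets of [A] and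
    [B]. The row [phi] is chosen to factor through [B] unless [B] is zero, and [x] to be killed by
    [A]. If no such [x] exists then [E] factors through [A], hence so does every [phi] with
    [phi *m E = phi]. *)
Lemma rank_one_preserving m (E A B : 'M[K]_m) :
    E != 0 -> E *m E = E -> A *m E = A -> B *m E = B ->
  exists x : 'cV_m, exists phi : 'rV_m,
  [/\ x != 0, phi != 0, E *m x = x & phi *m E = phi] /\
  (A *m x = 0 \/ exists psi, phi = psi *m A) /\
  (B *m x = 0 \/ exists psi, phi = psi *m B).
Proof.
move=> E0 EE AE BE.
have [phi [phi0 phiE phiB]] : exists phi : 'rV_m,
    [/\ phi != 0, phi *m E = phi & B = 0 \/ exists psi, phi = psi *m B].
  have [->|/exists_row[y yB]] := eqVneq B 0.
    have [y yE] := exists_row E0; exists (y *m E).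
    by split; [|rewrite -mulmxA EE|left].
  by exists (y *m B); split; [|rewrite -mulmxA BE|right; exists y].
have {}phiB x : B *m x = 0 \/ exists psi, phi = psi *m B.
  by case: phiB => [->|?]; [left; rewrite mul0mx|right].
have [[x [x0 xE Ax]]|[C CA]] := kernel_or_factor EE AE.
  by exists x, phi; split; last by split; [left|].
have [y yE] := exists_col E0; exists (E *m y), phi.
split; first by split; rewrite // mulmxA EE.
by split=> //; right; exists (phi *m C); rewrite -mulmxA -CA.
Qed.

End MatrixLemmas.

(** * Structure of bricks *)

Section Bricks.
Variables (K : fieldType) (n : nat) (E : finType) (src tgt : E -> 'I_n).
Local Notation P := (rsz_pres K src tgt).
Implicit Types (X Y : module P) (i j k : 'I_n) (a b c : E).

Definition brick X := (0 < mdim X)%N /\ dimHom X X = 1%N.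

Lemma brick_scalar X f : brick X -> f \in homspace X X -> exists t : K, f = t%:M.
Proof.
move=> [X0 dX] fH.
have I0 : (1%:M : 'M[K]_(mdim X)) != 0.
  apply/eqP => /matrixP/(_ (Ordinal X0) (Ordinal X0))/eqP.
  by rewrite !mxE eqxx oner_eq0.
have IH : (1%:M : 'M[K]_(mdim X)) \in homspace X X.
  by apply/homspaceP => g; rewrite mul1mx mulmx1.
have : (<[1%:M : 'M[K]_(mdim X)]> == homspace X X)%VS.
  by rewrite eqEdim -memvE IH dim_vline I0 [X in (X <= _)%N]dX.
move=> /eqP HE; move: fH; rewrite -HE => /vlineP[t ->].
by exists t; rewrite scalemx1.
Qed.

(** Endomorphisms of a brick are scalars, so one that kills a nonzero vector is zero. The later
    arguments by nilpotent endomorphisms all end here. *)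
Lemma brick_endo_eq0 X f p (u : 'M_(mdim X, p)) :
  brick X -> f \in homspace X X -> u != 0 -> f *m u = 0 -> f = 0.
Proof.
move=> bX /(brick_scalar bX)[t ->] /eqP u0; rewrite mul_scalar_mx.
move=> /eqP; rewrite scaler_eq0 => /orP[/eqP->|/eqP //].
by rewrite raddf0.
Qed.

Lemma arr_composable X a c : brick X -> tgt a = src c ->
  arr X a = 0 \/ arr X c = 0.
Proof.
move=> bX ac; have [->|/exists_col[x xa]] := eqVneq (arr X a) 0; first by left.
have [->|/exists_row[y yc]] := eqVneq (arr X c) 0; first by right.
have /eqP[] := mulmx_neq0 xa yc.
apply: (brick_endo_eq0 bX _ xa).
  apply: homP => [k|b].
    rewrite -!mulmxA arr_idm !mulmxA idm_arr -ac -scalemxAr -!scalemxAl.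
    by rewrite -!mulmxA.
  by rewrite -!mulmxA arr_arr !mulmxA arr_arr !mulmx0 !mul0mx.
by rewrite -!mulmxA (mulmxA (arr X c)) arr_arr !(mulmx0, mul0mx).
Qed.

Lemma arr_loop X a : brick X -> src a = tgt a -> arr X a = 0.
Proof. by move=> bX /esym/(arr_composable bX)[]. Qed.

Lemma brick_support X (S : pred 'I_n) i :
    brick X -> (forall a, arr X a != 0 -> S (src a) = S (tgt a)) ->
    S i -> idm X i != 0 ->
  forall k, idm X k != 0 -> S k.
Proof.
move=> bX SP Si i0 k.
pose f := \sum_(j | S j) idm X j.
have idf j : idm X j *m f = (S j)%:R *: idm X j.
  rewrite mulmx_sumr (eq_bigr (fun l => (j == l)%:R *: idm X j)); last first.
    by move=> l _; rewrite idm_idm.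
  rewrite -scaler_suml; congr (_ *: _); have [Sj|nSj] := boolP (S j).
    rewrite (bigD1 j) //= eqxx big1 ?addr0 // => l /andP[_ /negbTE].
    by rewrite eq_sym => ->.
  by rewrite big1 // => l Sl; have [jl|] := eqVneq j l; first by rewrite jl Sl in nSj.
have fid j : f *m idm X j = (S j)%:R *: idm X j.
  rewrite mulmx_suml (eq_bigr (fun l => (l == j)%:R *: idm X j)); last first.
    by move=> l _; rewrite idm_idm; case: eqP => [->|]; rewrite ?scale0r.
  rewrite -scaler_suml; congr (_ *: _); have [Sj|nSj] := boolP (S j).
    by rewrite (bigD1 j) //= eqxx big1 ?addr0 // => l /andP[_ /negbTE ->].
  by rewrite big1 // => l Sl; have [lj|] := eqVneq l j; first by rewrite -lj Sl in nSj.
have fH : f \in homspace X X.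
  apply: homP => [j|a]; first by rewrite idf fid.
  rewrite -[in LHS]idm_tgt mulmxA fid -scalemxAl idm_tgt.
  rewrite -[in RHS]arr_src -mulmxA idf -scalemxAr arr_src.
  by have [->|/SP->] := eqVneq (arr X a) 0; rewrite ?scaler0.
have [t ft] := brick_scalar bX fH.
have t1 : t = 1.
  have := idf i; rewrite ft mul_mx_scalar Si => /eqP.
  rewrite -subr_eq0 -scalerBl scaler_eq0 (negbTE i0) orbF subr_eq0.
  by move=> /eqP.
have := idf k; rewrite ft t1 mulmx1; case: (S k) => //.
by rewrite scale0r => ->; rewrite eqxx.
Qed.

(* [x] and [phi] prescribe a rank-one map at the vertex [i], which the
   summands [arr Y a *m x *m psi a] propagate along the arrows leaving [i]. *)
Lemma rank_one_hom X Y i (x : 'cV_(mdim Y)) (phi : 'rV_(mdim X))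
    (psi : E -> 'rV_(mdim X)) :
    idm Y i *m x = x -> phi *m idm X i = phi ->
    (forall a, psi a *m idm X (tgt a) = psi a) ->
    (forall a, phi *m arr X a = 0) ->
    (forall a b, arr Y a *m x *m psi a *m arr X b =
                 (a == b)%:R *: (arr Y a *m x *m phi)) ->
  x *m phi + \sum_a arr Y a *m x *m psi a \in homspace X Y.
Proof.
move=> ix phii psit phi0 psiarr; apply: homP => [k|b].
  rewrite mulmxDl mulmxDr mulmx_suml mulmx_sumr; congr (_ + _).
    rewrite -[in LHS]phii -[in RHS]ix -!mulmxA idm_idm !mulmxA idm_idm.
    rewrite eq_sym -!scalemxAr -!scalemxAl -!mulmxA phii.
    have [->|_] := eqVneq k i; last by rewrite !scale0r.
    by rewrite (mulmxA _ x) ix.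
  apply: eq_bigr => a _; rewrite -[in LHS]psit !mulmxA idm_arr -mulmxA idm_idm.
  rewrite eq_sym -!scalemxAr -!scalemxAl -!mulmxA.
  by rewrite psit.
rewrite mulmxDl mulmxDr mulmx_suml mulmx_sumr -mulmxA phi0 mulmx0 add0r.
rewrite [X in _ = _ + X]big1 ?addr0 => [|a _]; last first.
  by rewrite !mulmxA arr_arr !mul0mx.
rewrite (eq_bigr _ (fun a _ => psiarr a b)) (bigD1 b) //= eqxx scale1r.
by rewrite big1 ?addr0 ?mulmxA // => a /negbTE->; rewrite scale0r.
Qed.

Hypothesis src_le_tgt : forall a, (src a <= tgt a)%N.
Hypothesis in_uniq : forall a b,
  src a != tgt a -> src b != tgt b -> tgt a = tgt b -> a = b.
Hypothesis out_le2 : forall a b c, src a != tgt a -> src b != tgt b ->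
  src c != tgt c -> src a = src b -> src b = src c -> [\/ a = b, b = c | a = c].

Lemma arr_nonloop X a : brick X -> arr X a != 0 -> src a != tgt a.
Proof. by move=> bX; apply: contra_neq => /(arr_loop bX). Qed.

Lemma arr_in_uniq X Y a b : brick X -> brick Y ->
  arr X a != 0 -> arr Y b != 0 -> tgt a = tgt b -> a = b.
Proof.
move=> bX bY /(arr_nonloop bX) a0 /(arr_nonloop bY) b0.
exact: in_uniq.
Qed.

Lemma brick_root X : brick X ->
  exists i, idm X i != 0 /\ forall k, idm X k != 0 -> (i <= k)%N.
Proof.
move=> [X0 _].
have [k0 k0P] : exists k, idm X k != 0.
  apply/existsP; apply: contraT; rewrite negb_exists => /forallP h.
  have := sum_idm X; rewrite big1 => [|k _]; last by have := h k; move/negPn/eqP.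
  move=> /matrixP/(_ (Ordinal X0) (Ordinal X0))/eqP.
  by rewrite !mxE eqxx eq_sym oner_eq0.
case: (@arg_minnP _ k0 (fun k => idm X k != 0) (@nat_of_ord n) k0P) => i i0 imin.
by exists i; split.
Qed.

Lemma brick_star X i : brick X -> idm X i != 0 ->
    (forall k, idm X k != 0 -> (i <= k)%N) ->
  (forall a, arr X a != 0 -> src a = i /\ tgt a != i) /\
  (forall k, idm X k != 0 -> k = i \/ exists2 a, arr X a != 0 & tgt a = k).
Proof.
move=> bX i0 imin.
have srcN a : arr X a != 0 -> idm X (src a) != 0.
  by apply: contra_neq => s0; rewrite -arr_src s0 mulmx0.
have tgtN a : arr X a != 0 -> tgt a != i.
  move=> a0; apply/eqP => ti; have /negP[] := arr_nonloop bX a0.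
  by rewrite -val_eqE eqn_leq src_le_tgt ti /= imin // srcN.
(* [S] is the root with the targets of the acting arrows that leave it. An acting arrow that starts
   elsewhere cannot start in [S], as it would be composable with an acting one. It cannot end in [S]
   either, as it would share its target with an arrow from the root. *)
pose S k := (k == i) || [exists a, [&& arr X a != 0, src a == i & tgt a == k]].
have supp : forall k, idm X k != 0 -> S k.
  apply: (brick_support bX _ _ i0); last by rewrite /S eqxx.
  move=> c c0; rewrite /S (negbTE (tgtN c c0)) /=.
  have [sc|sc] /= := eqVneq (src c) i.
    by apply/esym/existsP; exists c; rewrite c0 sc !eqxx.
  apply/existsP/existsP => -[a /and3P[a0 /eqP sa /eqP ta]].
    by case: (arr_composable bX ta) => z; move: a0 c0; rewrite z eqxx.
  by move: sc; rewrite -(arr_in_uniq bX bX a0 c0 ta) sa eqxx.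
split=> [a a0|k /supp/orP[/eqP|/existsP[a /and3P[a0 _ /eqP]]]].
- split; last exact: tgtN.
  case/orP: (supp _ (srcN _ a0)) => [/eqP //|/existsP[b /and3P[b0 _ /eqP ba]]].
  by case: (arr_composable bX ba) => z; move: a0 b0; rewrite z eqxx.
- by left.
- by right; exists a.
Qed.

(* A brick is one-dimensional at its root [i] (with coordinate [phi] and basis
   vector [x]) and at the targets of the arrows acting nontrivially; [psi a] is
   the coordinate at [tgt a] for the basis vector [arr X a *m x]. *)
Record star X i (x : 'cV_(mdim X)) (phi : 'rV_(mdim X))
    (psi : E -> 'rV_(mdim X)) : Prop := Star {
  star_root : idm X i = x *m phi;
  star_coord : phi *m x = 1%:M;
  star_src : forall a, arr X a != 0 -> src a = i;
  star_tgt : forall a, arr X a != 0 -> tgt a != i;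
  star_leaf : forall a, arr X a != 0 ->
    psi a *m arr X a = phi /\ arr X a *m x *m psi a = idm X (tgt a);
  star_supp : forall k, idm X k != 0 ->
    k = i \/ exists2 a, arr X a != 0 & tgt a = k }.

(** Puts the acting arrows in the form expected by [rank_one_preserving], with zero matrices in the
    missing places when fewer than two arrows act. *)
Lemma two_arrows X i : brick X -> (forall a, arr X a != 0 -> src a = i) ->
  exists A B : 'M_(mdim X), [/\ A *m idm X i = A, B *m idm X i = B &
    forall a, arr X a != 0 -> arr X a = A \/ arr X a = B].
Proof.
move=> bX srcX.
have idi a : arr X a != 0 -> arr X a *m idm X i = arr X a.
  by move=> /srcX <-; rewrite arr_src.
have [a a0|X0] := pickP (fun a => arr X a != 0); last first.
  by exists 0, 0; split; rewrite ?mul0mx // => a; rewrite X0.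
have [b /andP[b0 ba]|Xa] := pickP (fun b => (arr X b != 0) && (b != a)); last first.
  exists (arr X a), 0; split; rewrite ?mul0mx ?idi // => c c0; left.
  by have := Xa c; rewrite c0 /= => /negbFE/eqP->.
exists (arr X a), (arr X b); split; rewrite ?idi // => c c0.
have nl := arr_nonloop bX.
case: (@out_le2 a b c); rewrite ?nl ?(srcX a) ?(srcX b) ?(srcX c) //.
- by move=> ab; rewrite ab eqxx in ba.
- by move=> ->; right.
- by move=> ->; left.
Qed.

Lemma brick_starP X : brick X -> exists i x phi psi, @star X i x phi psi.
Proof.
move=> bX; have [i [i0 imin]] := brick_root bX.
have [arrs supp] := brick_star bX i0 imin.
have arrS a : arr X a != 0 -> src a = i by case/arrs.
have arrT a : arr X a != 0 -> tgt a != i by case/arrs.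
have [A [B [Ai Bi AB]]] := two_arrows bX arrS.
have [x [phi [[x0 phi0 ix phii] [Ax Bx]]]] := rank_one_preserving i0 (idm_id X i) Ai Bi.
have phiarr a : phi *m arr X a = 0.
  rewrite -phii -mulmxA idm_arr; case: eqP => [ia|_]; last by rewrite scale0r mulmx0.
  have [->|/arrT] := eqVneq (arr X a) 0; first by rewrite scaler0 mulmx0.
  by rewrite -ia eqxx.
(* The row [psi a] extends the rank-one map to the target of [a]. It is zero where [arr X a] kills
   [x], and otherwise a factorisation of [phi] through [arr X a], cut down to the vertex [tgt a]. *)
have /fin_all_exists[psi psiP] a : exists psi : 'rV_(mdim X),
    [/\ psi *m idm X (tgt a) = psi, arr X a = 0 -> psi = 0 &
        arr X a *m x *m psi *m arr X a = arr X a *m x *m phi].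
  have : arr X a *m x = 0 \/ arr X a != 0 /\ exists psi, phi = psi *m arr X a.
    have [->|a0] := eqVneq (arr X a) 0; first by left; rewrite mul0mx.
    case: (AB a a0) => aE; rewrite aE.
      by case: Ax; [left|right; split; rewrite // -aE].
    by case: Bx; [left|right; split; rewrite // -aE].
  case=> [ax0|[a0 [psi psiE]]].
    by exists 0; split; rewrite ?mul0mx // ax0 !mul0mx.
  exists (psi *m idm X (tgt a)); split.
  - by rewrite -mulmxA idm_id.
  - by move=> /eqP; rewrite (negbTE a0).
  - by rewrite -!mulmxA idm_tgt psiE !mulmxA.
pose f := x *m phi + \sum_a arr X a *m x *m psi a.
have fH : f \in homspace X X.
  apply: rank_one_hom ix phii _ phiarr _ => [a|a b]; first by case: (psiP a).
  have [<-|ab] := eqVneq a b; first by rewrite scale1r; case: (psiP a).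
  rewrite scale0r; have [a0|a0] := eqVneq (arr X a) 0; first by rewrite a0 !mul0mx.
  have [b0|b0] := eqVneq (arr X b) 0; first by rewrite b0 mulmx0.
  have [<- _ _] := psiP a; rewrite -!mulmxA idm_arr.
  case: eqP => [tab|_]; last by rewrite scale0r !mulmx0.
  by rewrite (arr_in_uniq bX bX a0 b0 tab) eqxx in ab.
have [t ft] := brick_scalar bX fH.
(* At the root the endomorphism [f] is the rank-one map [x *m phi]. Being a nonzero scalar there, it
   forces dimension one, and dividing [phi] by [t] makes it the coordinate dual to [x]. *)
have ti : t *: idm X i = x *m phi.
  rewrite -mul_scalar_mx -ft mulmxDl -mulmxA phii mulmx_suml big1 ?addr0 // => a _.
  have [a0|/arrT ai] := eqVneq (arr X a) 0; first by rewrite a0 !mul0mx.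
  have [<- _ _] := psiP a; rewrite -!mulmxA idm_idm (negbTE ai).
  by rewrite scale0r !mulmx0.
have t0 : t != 0.
  by apply: contraTneq (mulmx_neq0 x0 phi0) => t0; rewrite -ti t0 scale0r eqxx.
have iE : idm X i = x *m (t^-1 *: phi).
  by rewrite -scalemxAr -ti scalerA mulVf // scale1r.
have phix : t^-1 *: phi *m x = 1%:M.
  have [v vx] := exists_dual x0.
  by rewrite -[LHS]mul1mx -vx -[in RHS]ix iE !mulmxA.
have arrE a : arr X a != 0 -> arr X a = arr X a *m x *m (t^-1 *: phi).
  by move=> a0; rewrite -mulmxA -iE -(arrS a a0) arr_src.
(* The factorisations [psi] may be zero at an acting arrow, so the coordinates at the leaves are
   built anew, from a row dual to [arr X a *m x]. *)
have /fin_all_exists[chi chiP] a : exists chi : 'rV_(mdim X), arr X a != 0 ->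
    chi *m arr X a = t^-1 *: phi /\ arr X a *m x *m chi = idm X (tgt a).
  have [a0|a0] := eqVneq (arr X a) 0; first by exists 0.
  have u0 : arr X a *m x != 0.
    by apply: (contraNneq _ a0) => u0; rewrite arrE // u0 mul0mx.
  have [w wu] := exists_dual u0; exists (w *m idm X (tgt a)) => _.
  split; first by rewrite -mulmxA idm_tgt arrE // mulmxA wu mul1mx.
  (* If not, some row [v] at [tgt a] annihilates the image of [arr X a], and
     [arr X a *m x *m v] is a nilpotent endomorphism. *)
  apply/eqP; rewrite eq_sym -subr_eq0; apply: contraT => /exists_row[y].
  set v := y *m _ => v0.
  have vt : v *m idm X (tgt a) = v.
    by rewrite /v -mulmxA mulmxBl idm_id -!mulmxA idm_id.
  have va : v *m (arr X a *m x) = 0.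
    have tx : idm X (tgt a) *m (arr X a *m x) = arr X a *m x.
      by rewrite mulmxA idm_tgt.
    by rewrite /v -mulmxA mulmxBl tx -!mulmxA tx wu mulmx1 subrr mulmx0.
  clearbody v.
  have varr b : v *m arr X b = 0.
    have [b0|b0] := eqVneq (arr X b) 0; first by rewrite b0 mulmx0.
    rewrite -vt -mulmxA idm_arr; case: eqP => [tab|_]; last by rewrite scale0r mulmx0.
    rewrite scale1r -(arr_in_uniq bX bX a0 b0 tab) arrE //.
    by rewrite mulmxA va mul0mx.
  have /eqP[] := mulmx_neq0 u0 v0; apply: (brick_endo_eq0 bX _ u0).
    apply: homP => [k|b].
      rewrite -[in LHS]vt -!mulmxA idm_idm (mulmxA (idm X k)) idm_arr eq_sym.
      by rewrite -!scalemxAr -!scalemxAl vt.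
    by rewrite -mulmxA varr !mulmxA arr_arr mulmx0 !mul0mx.
  by rewrite -(mulmxA _ v) va mulmx0.
by exists i, x, (t^-1 *: phi), chi; split.
Qed.

End Bricks.

(** * Extensions between bricks *)

Section Extensions.
Variables (K : fieldType) (n : nat) (E : finType) (src tgt : E -> 'I_n).
Local Notation P := (rsz_pres K src tgt).
Implicit Types (X Y : module P) (i j k : 'I_n) (a b c : E).

(** Loops act by zero on both bricks, so one term drops out of each Leibniz rule involving the loop
    [a]. What is left says that [carr d a] respects the vertices and has zero composite with every
    arrow on either side. *)
Lemma cocycle_loop_hom X Y (d : {ffun gen P -> 'M[K]_(mdim Y, mdim X)}) a :
    brick X -> brick Y -> d \in cocycles X Y -> src a = tgt a ->
  carr d a \in homspace X Y.
Proof.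
move=> bX bY dZ aL; have [Xa Ya] := (arr_loop bX aL, arr_loop bY aL).
apply: homP => [k|b].
  have := cocycle_arr_idm k a dZ; rewrite Ya mul0mx add0r => ->.
  have := cocycle_idm_arr k a dZ; rewrite Xa mulmx0 addr0 => ->.
  by rewrite aL.
have := cocycle_arr_arr a b dZ; rewrite Ya mul0mx add0r => ->.
by have := cocycle_arr_arr b a dZ; rewrite Xa mulmx0 addr0 => ->.
Qed.

(** The idempotents span a separable algebra, on which every derivation is inner. The witness [h]
    comes from the separability element, the sum of the tensors of each idempotent with itself. *)
Lemma cocycle_normalize X Y (d : {ffun gen P -> 'M[K]_(mdim Y, mdim X)}) :
  d \in cocycles X Y -> exists h, forall k, cidm (d + coboundary h) k = 0.
Proof.
move=> dZ; exists (\sum_j cidm d j *m idm X j) => k.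
have cidmD : cidm (d + coboundary (\sum_j cidm d j *m idm X j)) k =
    cidm d k + cidm (coboundary (\sum_j cidm d j *m idm X j)) k.
  by rewrite /cidm [LHS]ffunE.
rewrite cidmD cidm_coboundary mulmx_sumr mulmx_suml.
have hk : \sum_j cidm d j *m idm X j *m idm X k = cidm d k *m idm X k.
  rewrite (bigD1 k) //= -mulmxA idm_id big1 ?addr0 // => j /negbTE jk.
  by rewrite -mulmxA idm_idm jk scale0r mulmx0.
(* The Leibniz rule at the pair [k], [j] moves [idm Y k] across [cidm d j]; the sum over [j] then
   collapses because the idempotents add up to 1. *)
have kh : \sum_j idm Y k *m (cidm d j *m idm X j) = cidm d k *m idm X k - cidm d k.
  rewrite (eq_bigr (fun j => (k == j)%:R *: (cidm d k *m idm X j)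
                             - cidm d k *m idm X j)); last first.
    move=> j _; rewrite mulmxA -[X in X *m _](addrK (cidm d k *m idm X j)).
    by rewrite cocycle_idm_idm // mulmxBl -scalemxAl -mulmxA idm_id.
  rewrite sumrB -mulmx_sumr sum_idm mulmx1 (bigD1 k) //= eqxx scale1r.
  by rewrite big1 ?addr0 // => j /negbTE; rewrite eq_sym => ->; rewrite scale0r.
by rewrite hk kh [X in _ + X]addrAC subrr sub0r subrr.
Qed.

Hypothesis src_le_tgt : forall a, (src a <= tgt a)%N.
Hypothesis in_uniq : forall a b,
  src a != tgt a -> src b != tgt b -> tgt a = tgt b -> a = b.
Hypothesis out_le2 : forall a b c, src a != tgt a -> src b != tgt b ->
  src c != tgt c -> src a = src b -> src b = src c -> [\/ a = b, b = c | a = c].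

Lemma star_root_le X i x phi psi k :
  @star _ _ _ _ _ X i x phi psi -> idm X k != 0 -> (i <= k)%N.
Proof.
by move=> sX /(star_supp sX)[-> //|[a /(star_src sX) <- <-]].
Qed.

Lemma star_root_neq0 X i x phi psi : @star _ _ _ _ _ X i x phi psi ->
  x != 0 /\ idm X i != 0.
Proof.
move=> sX; have x0 : x != 0.
  apply: contraTneq (oner_neq0 K) => x0; rewrite negbK; apply/eqP.
  have := star_coord sX; rewrite x0 mulmx0 => /matrixP/(_ 0 0).
  by rewrite !mxE eqxx.
split=> //; apply: contraNneq x0 => i0.
by rewrite -[x]mulmx1 -(star_coord sX) mulmxA -(star_root sX) i0 mul0mx.
Qed.

Lemma star_idm_base X i x phi psi : @star _ _ _ _ _ X i x phi psi ->
  idm X i *m x = x.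
Proof. by move=> sX; rewrite (star_root sX) -mulmxA (star_coord sX) mulmx1. Qed.

Lemma star_coord_idm X i x phi psi : @star _ _ _ _ _ X i x phi psi ->
  phi *m idm X i = phi.
Proof. by move=> sX; rewrite (star_root sX) mulmxA (star_coord sX) mul1mx. Qed.

Lemma star_in_root X i x phi psi a : @star _ _ _ _ _ X i x phi psi ->
  tgt a = i -> arr X a = 0.
Proof.
move=> sX ai; apply/eqP; apply: contraT => /(star_tgt sX).
by rewrite ai eqxx.
Qed.

(* If [Y] uses no more arrows than [X] then [Y] is a quotient of [X]. *)
Lemma star_quotient X Y i xX phiX psiX xY phiY psiY :
    brick X -> brick Y ->
    @star _ _ _ _ _ X i xX phiX psiX -> @star _ _ _ _ _ Y i xY phiY psiY ->
    (forall a, arr Y a != 0 -> arr X a != 0) ->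
  homspace X Y != 0%VS.
Proof.
move=> bX bY sX sY YX.
pose f := xY *m phiX + \sum_a arr Y a *m xY *m (psiX a *m idm X (tgt a)).
have : f \in homspace X Y.
  apply: rank_one_hom (star_idm_base sY) (star_coord_idm sX) _ _ _ => [a|a|a b].
  - by rewrite -mulmxA idm_id.
  - rewrite -(star_coord_idm sX) -mulmxA idm_arr.
    have [/esym ai|_] := eqVneq i (tgt a); last by rewrite scale0r mulmx0.
    by rewrite (star_in_root sX ai) scaler0 mulmx0.
  - have [Ya|Ya] := eqVneq (arr Y a) 0; first by rewrite Ya !mul0mx scaler0.
    have [<-|ab] := eqVneq a b.
      rewrite scale1r -!mulmxA idm_tgt.
      by have [-> _] := star_leaf sX (YX a Ya).
    rewrite scale0r -!mulmxA idm_arr.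
    have [b0|Xb] := eqVneq (arr X b) 0; first by rewrite b0 !(scaler0, mulmx0).
    have [tab|_] := eqVneq (tgt a) (tgt b); last by rewrite scale0r !mulmx0.
    by rewrite (arr_in_uniq in_uniq bY bX Ya Xb tab) eqxx in ab.
move=> fH; apply: contraTneq fH => ->; rewrite memv0.
have [xY0 _] := star_root_neq0 sY.
(* The homomorphism [f] is nonzero since at the root it is [xY *m phiX], which sends [xX] to
   [xY]. *)
apply: contraNneq xY0 => f0; rewrite -[xY]mulmx1 -(star_coord sX) mulmxA.
rewrite -[X in X *m _](addr0 _) -(star_idm_base sY) -mulmxA.
have <- : idm Y i *m f = idm Y i *m (xY *m phiX).
  rewrite mulmxDr mulmx_sumr big1 ?addr0 // => a _.
  rewrite !mulmxA idm_arr; have [/esym ai|_] := eqVneq i (tgt a).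
    by rewrite (star_in_root sY ai) !(scaler0, mul0mx).
  by rewrite scale0r !mul0mx.
by rewrite f0 mulmx0 add0r mul0mx.
Qed.

Lemma star_leaf_idm X i x phi psi a : @star _ _ _ _ _ X i x phi psi ->
  arr X a != 0 -> psi a *m idm X (tgt a) = psi a.
Proof.
move=> sX /(star_leaf sX)[psiE <-].
by rewrite -mulmxA mulmxA psiE mulmxA (star_coord sX) mul1mx.
Qed.

Section Pair.
Variables (X Y : module P) (i j : 'I_n).
Variables (xX : 'cV[K]_(mdim X)) (phiX : 'rV[K]_(mdim X)) (psiX : E -> 'rV[K]_(mdim X)).
Variables (xY : 'cV[K]_(mdim Y)) (phiY : 'rV[K]_(mdim Y)) (psiY : E -> 'rV[K]_(mdim Y)).
Hypotheses (bX : brick X) (bY : brick Y).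
Hypotheses (sX : star i xX phiX psiX) (sY : star j xY phiY psiY).
Hypothesis ji : (j <= i)%N.
Implicit Types d : {ffun gen P -> 'M[K]_(mdim Y, mdim X)}.

Lemma carr_idm d a : d \in cocycles X Y -> (forall k, cidm d k = 0) ->
  idm Y (tgt a) *m carr d a = carr d a /\ carr d a *m idm X (src a) = carr d a.
Proof.
move=> dZ d0; have := cocycle_idm_arr (tgt a) a dZ.
rewrite d0 mul0mx addr0 eqxx scale1r => ->.
by have := cocycle_arr_idm (src a) a dZ; rewrite d0 mulmx0 add0r eqxx scale1r.
Qed.

(** Such an arrow goes strictly upwards from the support of [X] to that of [Y]. Its target exceeds
    [i], hence [j], and so is a leaf of [Y]. The acting arrow of [Y] that ends there is [a] itself,
    so that [src a] is [j], and [i <= src a] together with [j <= i] makes the roots equal. *)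
Lemma carr_neq0 d a : d \in cocycles X Y -> (forall k, cidm d k = 0) ->
    (forall b, src b = tgt b -> carr d b = 0) ->
    carr d a != 0 -> [/\ arr Y a != 0, src a = i & i = j].
Proof.
move=> dZ d0 dL a0; have [dt ds] := carr_idm a dZ d0.
have aL : src a != tgt a by apply: contra_neq a0 => /dL.
have ia : (i <= src a)%N.
  by apply: (star_root_le sX); apply: contra_neq a0 => z; rewrite -ds z mulmx0.
have Yt : idm Y (tgt a) != 0.
  by apply: contra_neq a0 => z; rewrite -dt z mul0mx.
have sa : (src a < tgt a)%N.
  by rewrite ltn_neqAle src_le_tgt andbT; apply: contraNneq aL => /val_inj ->.
have [taj|[b Yb tba]] := star_supp sY Yt.
  by move: (leq_trans (leq_ltn_trans ia sa) (eq_leq (congr1 val taj))); rewrite ltnNge ji.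
have ba : b = a by apply: in_uniq tba; rewrite // (arr_nonloop bY).
rewrite -{1}ba; split => //.
  apply/val_inj/eqP; rewrite eqn_leq ia andbT /=.
  by rewrite -ba (star_src sY Yb).
apply/val_inj/eqP; rewrite eqn_leq ji andbT /= (leq_trans ia) //.
by rewrite -ba (star_src sY Yb).
Qed.

End Pair.

Lemma normalized_self_coboundary X i x phi psi
    (d : {ffun gen P -> 'M[K]_(mdim X, mdim X)}) :
    brick X -> @star _ _ _ _ _ X i x phi psi ->
    d \in cocycles X X -> (forall k, cidm d k = 0) ->
    (forall b, src b = tgt b -> carr d b = 0) ->
  d \in coboundaries X X.
Proof.
move=> bX sX dZ d0 dL.
have dX a : carr d a != 0 -> arr X a != 0.
  by case/(carr_neq0 bX sX sX (leqnn _) dZ d0 dL).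
have dt a := (carr_idm a dZ d0).1; have ds a := (carr_idm a dZ d0).2.
(* Up to sign, the witness sends the basis vector [arr X a *m x] of each leaf to [carr d a *m x].
   Composed with [arr X b] it gives back [carr d b], and no arrow acts on its image, which lies in
   the leaves. *)
apply/coboundariesP; exists (- \sum_a carr d a *m x *m psi a).
apply/ffunP => -[k|b].
  rewrite [LHS]d0 -[RHS]/(cidm (coboundary _) k) cidm_coboundary.
  rewrite mulmxN mulNmx opprK mulmx_sumr mulmx_suml addrC.
  apply/esym/eqP; rewrite subr_eq0; apply/eqP/eq_bigr => a _.
  have [->|/dX Xa] := eqVneq (carr d a) 0; first by rewrite !(mulmx0, mul0mx).
  rewrite -[in LHS](star_leaf_idm sX Xa) -(dt a) -!mulmxA idm_idm.
  rewrite (mulmxA (idm X k)) idm_idm eq_sym -!scalemxAr -!scalemxAl.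
  rewrite (star_leaf_idm sX Xa).
  by have [->|_] := eqVneq k (tgt a); last rewrite !scale0r.
rewrite -[LHS]/(carr d b) -[RHS]/(carr (coboundary _) b) carr_coboundary.
rewrite mulmxN mulNmx opprK mulmx_sumr mulmx_suml big1 ?oppr0 ?add0r; last first.
  move=> a _; rewrite !mulmxA.
  have [->|/dX Xa] := eqVneq (carr d a) 0; first by rewrite !(mulmx0, mul0mx).
  rewrite -(dt a) mulmxA arr_idm; case: eqP => [ta|_]; last by rewrite !(scale0r, mul0mx).
  have [b0|/(star_src sX) sb] := eqVneq (arr X b) 0.
    by rewrite b0 !(scaler0, mul0mx).
  by have := star_tgt sX Xa; rewrite ta sb eqxx.
rewrite (bigD1 b) //= big1 ?addr0; last first.
  move=> a ab.
  have [->|/dX Xa] := eqVneq (carr d a) 0; first by rewrite !(mulmx0, mul0mx).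
  rewrite -(star_leaf_idm sX Xa) -!mulmxA idm_arr.
  have [b0|Xb] := eqVneq (arr X b) 0; first by rewrite b0 !(scaler0, mulmx0).
  case: eqP => [tab|_]; last by rewrite !(scale0r, mulmx0).
  by rewrite (arr_in_uniq in_uniq bX bX Xa Xb tab) eqxx in ab.
have [->|/dX Xb] := eqVneq (carr d b) 0; first by rewrite !mul0mx.
have [psiE _] := star_leaf sX Xb.
by rewrite -!mulmxA psiE -(star_root sX) -(star_src sX Xb) ds.
Qed.

Lemma normalized_orth_coboundary X Y i j xX phiX psiX xY phiY psiY
    (d : {ffun gen P -> 'M[K]_(mdim Y, mdim X)}) :
    brick X -> brick Y ->
    @star _ _ _ _ _ X i xX phiX psiX -> @star _ _ _ _ _ Y j xY phiY psiY ->
    (j <= i)%N -> homspace X Y = 0%VS -> homspace Y X = 0%VS ->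
    d \in cocycles X Y -> (forall k, cidm d k = 0) ->
    (forall b, src b = tgt b -> carr d b = 0) ->
  d \in coboundaries X Y.
Proof.
move=> bX bY sX sY ji XY YX dZ d0 dL.
have dY := carr_neq0 bY sX sY ji dZ d0 dL.
have dt a := (carr_idm a dZ d0).1; have ds a := (carr_idm a dZ d0).2.
have [a0 a00|dA] := pickP (fun a => carr d a != 0); last first.
  suff -> : d = 0 by apply: mem0v.
  apply/ffunP => -[k|a]; rewrite [RHS]ffunE; first exact: d0.
  by apply/eqP; have := dA a => /negbFE.
have ij : i = j by case: (dY _ a00).
subst j.
(* Roots being equal, [star_quotient] would give a nonzero homomorphism if one module used only
   arrows of the other. Hence each uses an arrow that the other does not. *)
have [a /andP[Ya Xa]] : exists a, (arr Y a != 0) && (arr X a == 0).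
  apply/existsP; apply: contraT; rewrite negb_exists => /forallP h.
  have /negP[] := star_quotient bX bY sX sY (fun a Ya =>
    ltac:(by have := h a; rewrite Ya)); by rewrite XY.
have [b /andP[Xb Yb]] : exists b, (arr X b != 0) && (arr Y b == 0).
  apply/existsP; apply: contraT; rewrite negb_exists => /forallP h.
  have /negP[] := star_quotient bY bX sY sX (fun a Xa =>
    ltac:(by have := h a; rewrite Xa)); by rewrite YX.
(* At most two arrows leave the common root and one of them, [b], acts by zero on [Y]. So [a] is the
   only arrow acting on [Y], and the only one at which [d] can be nonzero. *)
have Ya_only c : arr Y c != 0 -> c = a.
  move=> Yc; have ab : a <> b by move=> ab; rewrite ab Yb in Ya.
  have cb : c <> b by move=> cb; rewrite cb Yb in Yc.
  case: (@out_le2 b a c); rewrite ?(arr_nonloop bX Xb) ?(arr_nonloop bY Ya)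
    ?(arr_nonloop bY Yc) ?(star_src sX Xb) ?(star_src sY Ya) ?(star_src sY Yc) //.
  - by move=> ba; case: ab.
  - by move=> bc; case: cb.
have sa := star_src sY Ya.
have [_ leafE] := star_leaf sY Ya.
have dsi : carr d a *m idm X i = carr d a by rewrite -[in LHS]sa ds.
(* The witness lifts [carr d a] through [arr Y a], which identifies the root of [Y] with the leaf
   [tgt a]. It is supported at the root of [X], where no arrow acting on [X] ends. *)
apply/coboundariesP; exists (xY *m psiY a *m carr d a).
apply/ffunP => -[k|c].
  rewrite [LHS]d0 -[RHS]/(cidm (coboundary _) k) cidm_coboundary.
  rewrite -[in X in _ - X]dsi -!mulmxA idm_idm (mulmxA (idm Y k)).
  have -> : idm Y k *m xY = (k == i)%:R *: xY.
    rewrite -[in LHS](star_idm_base sY) mulmxA idm_idm -scalemxAl.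
    have [->|_] := eqVneq k i; last by rewrite !scale0r.
    by rewrite (star_idm_base sY).
  by rewrite -!scalemxAr -!scalemxAl dsi eq_sym subrr.
rewrite -[LHS]/(carr d c) -[RHS]/(carr (coboundary _) c) carr_coboundary.
have -> : xY *m psiY a *m carr d a *m arr X c = 0.
  rewrite -dsi -!mulmxA idm_arr.
  have [/esym ci|_] := eqVneq i (tgt c); last by rewrite scale0r !mulmx0.
  by rewrite (star_in_root sX ci) !(scaler0, mulmx0).
rewrite subr0 !mulmxA.
have [Yc|/Ya_only->] := eqVneq (arr Y c) 0; last by rewrite leafE dt.
rewrite Yc !mul0mx; apply/eqP; apply: contraT => /dY[].
by rewrite Yc eqxx.
Qed.

Lemma dimExt1_orth X Y i j xX phiX psiX xY phiY psiY :
    brick X -> brick Y ->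
    @star _ _ _ _ _ X i xX phiX psiX -> @star _ _ _ _ _ Y j xY phiY psiY ->
    (j <= i)%N -> homspace X Y = 0%VS -> homspace Y X = 0%VS ->
  dimExt1 X Y = 0%N.
Proof.
move=> bX bY sX sY ji XY YX; apply/eqP; rewrite subn_eq0; apply: dimvS.
apply/subvP => d dZ; have [h dh0] := cocycle_normalize dZ.
rewrite -[d](addrK (coboundary h)) rpredB //; last by apply/coboundariesP; exists h.
apply: (normalized_orth_coboundary bX bY sX sY ji XY YX _ dh0).
  by rewrite rpredD // coboundaries_cocycle.
move=> b bL; rewrite /carr ffunE -[coboundary h (inr b)]/(carr (coboundary h) b).
rewrite carr_coboundary (arr_loop bX bL) (arr_loop bY bL) mul0mx mulmx0 subrr addr0.
by have := cocycle_loop_hom bX bY dZ bL; rewrite XY memv0 => /eqP.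
Qed.

Definition loops i : pred E := [pred a | (src a == i) && (tgt a == i)].

(** Evaluation at the loops of the root sends cocycles to tuples of scalars, and its kernel consists
    of coboundaries; rank-nullity gives the bound. *)
Lemma dimExt1_self X i x phi psi : brick X -> @star _ _ _ _ _ X i x phi psi ->
  (dimExt1 X X <= #|loops i|)%N.
Proof.
move=> bX sX; have [X0 _] := bX; pose r0 := Ordinal X0.
pose T : vectType K := {ffun {a | loops i a} -> K^o}.
(* At a loop the value of a cocycle is a scalar matrix, so a single diagonal entry determines it. *)
pose F (d : {ffun gen P -> 'M[K]_(mdim X, mdim X)}) : T :=
  [ffun l => carr d (val l) r0 r0].
have FL : linear F by move=> t u v; apply/ffunP => l; rewrite !ffunE /carr !ffunE !mxE.
rewrite leq_subLR -(limg_ker_dim (linfun F) (cocycles X X)) leq_add //; last first.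
  apply: leq_trans (dimvS (subvf _)) _.
  by rewrite dimvf /dim /= muln1 card_sig.
apply/dimvS/subvP => d; rewrite memv_cap memv_ker (linfun_linearE FL).
move=> /andP[dZ /eqP F0].
have dL b : src b = tgt b -> carr d b = 0.
  move=> bL; have dH := cocycle_loop_hom bX bX dZ bL.
  have [bi|bi] := boolP (loops i b).
    have [t dt] := brick_scalar bX dH.
    have /ffunP/(_ (Sub b bi)) := F0; rewrite !ffunE /= dt mxE eqxx mulr1n => ->.
    by rewrite raddf0.
  (* At a loop based elsewhere the value is an endomorphism that kills the root vertex, hence
     zero. *)
  have [_ i0] := star_root_neq0 sX; apply: (brick_endo_eq0 bX dH i0).
  have := cocycle_arr_idm i b dZ; rewrite (arr_loop bX bL) mul0mx add0r => ->.
  move: bi; rewrite /loops /= -bL andbb eq_sym => /negbTE ->.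
  by rewrite scale0r.
have [h dh0] := cocycle_normalize dZ.
rewrite -[d](addrK (coboundary h)) rpredB //; last by apply/coboundariesP; exists h.
apply: (normalized_self_coboundary bX sX _ dh0).
  by rewrite rpredD // coboundaries_cocycle.
move=> b bL; rewrite /carr ffunE -[coboundary h (inr b)]/(carr (coboundary h) b).
rewrite carr_coboundary (arr_loop bX bL) mul0mx mulmx0 subrr addr0.
exact: dL.
Qed.

End Extensions.

(** * Spectral radius of matrices of natural numbers *)

Section SpectralRadius.
Variables (m : nat) (A : 'M[nat]_m).
Local Notation AC := (map_mx (fun k : nat => k%:R : algC) A).

Lemma char_poly_rootE z :
  (z \in sval (closed_field_poly_normal (char_poly AC))) = root (char_poly AC) z.
Proof.
case: closed_field_poly_normal => s /= sE.
rewrite [in RHS]sE (monicP (char_poly_monic _)) scale1r.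
by rewrite root_prod_XsubC.
Qed.

Lemma spectral_radius_le (c : algC) : 0 <= c ->
  (forall z, eigenvalue AC z -> `|z| <= c) -> spectral_radius A <= c.
Proof.
move=> c0 Ac; rewrite /spectral_radius big_seq; apply: bigmax_le => // z.
by rewrite char_poly_rootE -eigenvalue_root_char => /Ac.
Qed.

Lemma spectral_radius_ge (z : algC) :
  eigenvalue AC z -> `|z| <= spectral_radius A.
Proof.
rewrite eigenvalue_root_char -char_poly_rootE /spectral_radius.
elim: (sval _) => [//|y s IHs]; rewrite inE big_cons.
(* The order of [algC] is partial; the maximum behaves as expected because norms are real, hence
   comparable. *)
have big0 : 0 <= \big[Num.max/0 : algC]_(w <- s) `|w|.
  by elim/big_ind: _ => // a b a0 b0; rewrite maxEle; case: ifP.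
have realmax : (`|y| >=< \big[Num.max/0 : algC]_(w <- s) `|w|)%O.
  by rewrite real_comparable ?ger0_real.
rewrite comparable_le_max // => /orP[/eqP->|/IHs->]; by rewrite ?lexx ?orbT.
Qed.

Lemma spectral_radius_triangular (r : 'I_m -> nat) (c : nat) :
    (forall i j, i != j -> (r j <= r i)%N -> A i j = 0%N) ->
    (forall i, (A i i <= c)%N) ->
  spectral_radius A <= c%:R.
Proof.
move=> Atri Ac; apply: spectral_radius_le => [|z /eigenvalueP[v vA /rV0Pn[j0 vj0]]].
  exact: ler0n.
(* For a left eigenvector [v], take [j] minimal for [r] in its support. Off-diagonal entries of
   column [j] vanish on that support, so the eigenvalue is [A j j]. *)
case: (@arg_minnP _ j0 (fun j => v 0 j != 0) r vj0) => j vj jmin.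
have /matrixP/(_ 0 j) := vA; rewrite !mxE (bigD1 j) //= big1 ?addr0.
  rewrite mxE mulrC => /(mulIf vj) <-.
  by rewrite normr_nat ler_nat.
move=> i ij; have [->|vi] := eqVneq (v 0 i) 0; first by rewrite mul0r.
by rewrite mxE Atri ?mulr0 // jmin.
Qed.

End SpectralRadius.

Lemma spectral_radius1 (A : 'M[nat]_1) : (A 0 0)%:R <= spectral_radius A.
Proof.
rewrite -[leLHS]normr_nat; apply: spectral_radius_ge.
apply/eigenvalueP; exists 1%:M.
  by apply/matrixP => i j; rewrite !ord1 mul1mx !mxE eqxx mulr1.
by apply/rV0Pn; exists 0; rewrite mxE eqxx oner_neq0.
Qed.

(** * The simple module at a vertex and its self-extensions *)

Section SimpleModule.
Variables (K : fieldType) (n : nat) (E : finType) (src tgt : E -> 'I_n) (i : 'I_n).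
Local Notation P := (rsz_pres K src tgt).

Definition simple_act (g : 'I_n + E) : 'M[K]_1 :=
  if g is inl k then (k == i)%:R%:M else 0.

Lemma simple_axiom (r : rsz_rel 'I_n E) :
  @rel_value K P 1 simple_act r = 0.
Proof.
case: r => [[[[[k j]|[]]|[k a]]|[a k]]|[a b]]; rewrite /rel_value /=.
- rewrite sum_delta2 sum_deltaN scale0r addr0 /= -scalar_mxM -natrM mulnb.
  have [<-|kj] := eqVneq k j; first by rewrite andbb scale1r subrr.
  rewrite scale0r subr0.
  have [<-|_] := eqVneq k i; last by rewrite raddf0.
  by rewrite eq_sym (negbTE kj) raddf0.
- rewrite sum_scale00 add0r sum_inl (bigD1 i) //= eqxx big1 => [|k /negbTE->].
    by rewrite addr0 scaleN1r subrr.
  by rewrite raddf0.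
- by rewrite sum_delta2 sum_deltaN /= mulmx0 !scaler0 scale0r oppr0 !addr0.
- by rewrite sum_delta2 sum_deltaN /= mul0mx !scaler0 scale0r oppr0 !addr0.
- by rewrite sum_delta2 sum_scale0 /= mul0mx scale0r !addr0.
Qed.

Definition simple : module P := @Module K P 1 simple_act simple_axiom.

Lemma simple_homspace : homspace simple simple = fullv.
Proof.
apply/eqP; rewrite eqEsubv subvf; apply/subvP => f _; apply: homP => [k|a].
  by rewrite /idm /= mul_scalar_mx mul_mx_scalar.
by rewrite /arr /= mulmx0 mul0mx.
Qed.

Lemma simple_brick_set : brick_set (fun _ : 'I_1 => simple).
Proof.
split=> // a b; rewrite /dimHom simple_homspace dimvf !ord1 eqxx.
by rewrite /dim /=.
Qed.

Lemma simple_coboundaries : coboundaries simple simple = 0%VS.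
Proof.
apply/eqP; rewrite -subv0; apply/subvP => d /coboundariesP[h ->].
rewrite memv0; apply/eqP/ffunP => -[k|a]; rewrite !ffunE /=.
  by rewrite mul_scalar_mx mul_mx_scalar subrr.
by rewrite mulmx0 mul0mx subrr.
Qed.

(** Every choice of scalars at the loops of [i] is a cocycle, by the injective map [F], and there
    are no nonzero coboundaries since the generators act by scalars. *)
Lemma simple_dimExt1 : (#|loops src tgt i| <= dimExt1 simple simple)%N.
Proof.
rewrite /dimExt1 simple_coboundaries dimv0 subn0.
pose T : vectType K := {ffun {a | loops src tgt i a} -> K^o}.
pose F (t : T) : {ffun gen P -> 'M[K]_(mdim simple, mdim simple)} :=
  [ffun g => if g is inr a then
     (oapp t 0 (insub a : option {a | loops src tgt i a}))%:M else 0].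
have FL : linear F.
  move=> s u v; apply/ffunP => -[k|a]; rewrite !ffunE; first by rewrite scaler0 addr0.
  case: insub => [l|] /=; last by rewrite raddf0 scaler0 addr0.
  by rewrite !ffunE raddfD /= -scale_scalar_mx.
have -> : #|loops src tgt i| = \dim (linfun F @: fullv).
  rewrite limg_dim_eq; first by rewrite dimvf /dim /= muln1 card_sig.
  apply/eqP; rewrite -subv0; apply/subvP => t; rewrite memv_cap memv_ker.
  rewrite (linfun_linearE FL) memvf memv0 => /eqP/ffunP t0.
  apply/eqP/ffunP => -[a al]; have := t0 (inr a); rewrite !ffunE insubT /=.
  by move=> /matrixP/(_ 0 0); rewrite !mxE eqxx mulr1n.
apply/dimvS/subvP => _ /memv_imgP[t _ ->]; rewrite (linfun_linearE FL).
apply/cocycleP => -[[[[[k j]|[]]|[k a]]|[a k]]|[a b]]; rewrite /cocycle_rel /=.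
- by rewrite sum_delta2 sum_deltaN !ffunE mulmx0 mul0mx scaler0 oppr0 !addr0.
- by rewrite sum_scale00 add0r sum_inl big1 // => k _; rewrite ffunE.
- rewrite sum_delta2 sum_deltaN !ffunE mulmx0 addr0 /=.
  case: insubP => [l /andP[_ /eqP ->] _|_] /=; last first.
    by rewrite raddf0 mulmx0 scaler0 subrr.
  by rewrite mul_scalar_mx subrr.
- rewrite sum_delta2 sum_deltaN !ffunE mulmx0 add0r /=.
  case: insubP => [l /andP[/eqP -> _] _|_] /=; last first.
    by rewrite raddf0 mul0mx scaler0 subrr.
  by rewrite mul_mx_scalar subrr.
- by rewrite sum_delta2 sum_scale0 /= mul0mx mulmx0 !addr0.
Qed.

End SimpleModule.

(** * The Frobenius-Perron dimension for forests with loops and at most two arrows out of each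
    vertex *)

Lemma fpd_forest (K : fieldType) (n : nat) (E : finType) (src tgt : E -> 'I_n) :
    (0 < n)%N ->
    (forall a, src a <= tgt a)%N ->
    (forall a b, src a != tgt a -> src b != tgt b -> tgt a = tgt b -> a = b) ->
    (forall a b c, src a != tgt a -> src b != tgt b -> src c != tgt c ->
       src a = src b -> src b = src c -> [\/ a = b, b = c | a = c]) ->
  fpd_is (rsz_pres K src tgt) (\max_(i < n) #|loops src tgt i|)%N%:R.
Proof.
move=> n0 src_le in_uniq out_le2; split=> [m X [X0 XH]|y Xy].
  have bX i : brick (X i) by split; [exact: X0|rewrite XH eqxx].
  have /fin_all_exists[r rP] i := brick_starP src_le in_uniq out_le2 (bX i).
  (* Upper bound: the roots [r] of the bricks order the adjacency matrix. *)
  apply: (spectral_radius_triangular (r := r)) => [i j ij rji|i]; rewrite mxE.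
    have [xi [phii [psii si]]] := rP i; have [xj [phij [psij sj]]] := rP j.
    have X0j k l : k != l -> homspace (X k) (X l) = 0%VS.
      by move=> /negbTE kl; apply/eqP; rewrite -dimv_eq0 [X in X == _]XH kl.
    apply: (dimExt1_orth src_le in_uniq out_le2 (bX i) (bX j) si sj rji).
      exact: X0j.
    by apply: X0j; rewrite eq_sym.
  have [xi [phii [psii si]]] := rP i.
  apply: leq_trans (dimExt1_self src_le in_uniq (bX i) si) _.
  exact: (leq_bigmax (r i)).
(* Lower bound: the simple module at a vertex with the most loops, as a brick set with one
   element. *)
have [|i ->] := @bigop.eq_bigmax 'I_n (fun i => #|loops src tgt i|).
  by rewrite card_ord.
apply: le_trans (Xy 1%N _ (simple_brick_set K src tgt i)).
apply: le_trans (spectral_radius1 _).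
by rewrite mxE ler_nat simple_dimExt1.
Qed.

Theorem theorem5p2 (K : closedFieldType) (n : nat) (N : 'I_n -> nat)
    (hn : (4 <= n)%N) :
  fpd_is (D_pres K N) ((\max_(i < n) N i)%N%:R).
Proof.
have srcE (b : 'I_n.-1) : nat_of_ord (D_src (inl b : D_arrow N)) =
    (if b == (n - 2)%N :> nat then n - 3 else b)%N.
  by rewrite /D_src; case: ifP.
have tgtE (b : 'I_n.-1) : nat_of_ord (D_tgt (inl b : D_arrow N)) = b.+1 by [].
have arrow (a : D_arrow N) : D_src a != D_tgt a -> exists b, a = inl b.
  by case: a => [b|l]; [exists b|rewrite eqxx].
have -> : (\max_(i < n) N i)%N =
    (\max_(i < n) #|loops (@D_src n N) (@D_tgt n N) i|)%N.
  apply: eq_bigr => i _.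
  pose f (l : 'I_(N i)) : D_arrow N := inr (Tagged (fun j => 'I_(N j)) l).
  have f_inj : injective f.
    by move=> l l' [] /eqP; rewrite -tag_eqE /tag_eq /= eqxx tagged_asE => /eqP.
  rewrite -[LHS]card_ord -(card_imset _ f_inj); apply: eq_card => -[b|l].
    (* An arrow [inl b] is never a loop: its target is [b.+1] and its source is [b], or [n - 3] when
       [b] is [n - 2]. *)
    apply/imsetP/idP => [[] //|]; rewrite /loops !inE => /andP[/eqP sb /eqP tb].
    have := congr1 (@nat_of_ord n) (etrans sb (esym tb)); rewrite srcE tgtE.
    by have := ltn_ord b; case: ifP; lia.
  apply/imsetP/idP => [[l' _ [->]]|]; rewrite /loops !inE /= ?eqxx //.
  by case: l => j l /= /andP[/eqP ji _]; subst j; exists l.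
apply: fpd_forest => [|[b|l]|a a'|a a' a''] //.
- lia.
- by rewrite srcE tgtE; have := ltn_ord b; case: ifP; lia.
- move=> /arrow[b ->] /arrow[b' ->] /(congr1 (@nat_of_ord n)); rewrite !tgtE => -[bb'].
  by congr inl; apply: val_inj.
move=> /arrow[b ->] /arrow[b' ->] /arrow[b'' ->].
move=> /(congr1 (@nat_of_ord n)); rewrite !srcE => h.
move=> /(congr1 (@nat_of_ord n)); rewrite !srcE => h'.
(* Only the indices [n - 3] and [n - 2] share a source, so among three arrows with a common source
   two coincide. *)
have [bb'|[bb'|bb']] : b = b' :> nat \/ b' = b'' :> nat \/ b = b'' :> nat.
- by move: h h'; do 3![case: eqP]; lia.
- by apply: Or31; congr inl; apply: val_inj.
- by apply: Or32; congr inl; apply: val_inj.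
- by apply: Or33; congr inl; apply: val_inj.
Qed.
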